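(* Let $(X,d,\mu)$ be a metric measure space, where $\mu$ is a doubling Borel measure. Let $E\subset X$ be a measurable subset and $f:E\to\mathbb{R}$ a $\mu$-measurable function. Then $f$ satisfies $$\operatorname{ap\,limsup}_{y\to x}\frac{|f(y)-f(x)|}{d(x,y)}<\infty$$ for $\mu$-a.e. $x$ in $E$ if and only if for any $\varepsilon>0$ there is a closed set $G\subset E$ such that $\mu(E\setminus G)\le\varepsilon$ and $f$ is locally Lipschitz on $G$.
   Context: A metric measure space $(X,d,\mu)$ is a separable metric space $(X,d)$ with a non-trivial, locally finite Borel regular measure $\mu$. $B(x,r)=\{y\in X: d(x,y)<r\}$. The measure $\mu$ is doubling if there is $C_\mu>0$ with $\mu(B(x,2r))\le C_\mu\,\mu(B(x,r))$ for all $x\in X$, $r>0$. A set $A$ has density zero at $x$ if $\lim_{r\to0}\mu(B(x,r)\cap A)/\mu(B(x,r))=0$. $\operatorname{ap\,limsup}_{y\to x}F(y)$ is the infimum of the set of numbers $a\in\mathbb{R}$ for which the set $\{y: F(y)>a\}$ has density zero at $x$; for a function defined on $E$, the points $y$ are taken in $E$ (and $y\ne x$ for the difference quotient). *)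

(* Defs.v *)
From HB Require Import structures.
From mathcomp Require Import all_boot all_order all_algebra.
From mathcomp Require Import all_classical all_reals all_analysis.

Set Implicit Arguments.
Unset Strict Implicit.
Unset Printing Implicit Defensive.

Import Order.TTheory GRing.Theory Num.Theory.
Import numFieldNormedType.Exports.

Local Open Scope classical_set_scope.
Local Open Scope ring_scope.

Definition separable_space (X : topologicalType) : Prop :=
  exists D : set X, countable D /\ dense D.

Definition borel_sets (X : topologicalType) : set (set X) := <<s @open X >>.

(* A measure on X is, as usual in analysis on metric spaces, an outer measure
   defined on all subsets; "measurable" means Caratheodory measurable. *)
Definition borel_regular (R : realType) (X : topologicalType)
    (mu : {outer_measure set X -> \bar R}) : Prop :=
  (forall B : set X, borel_sets B -> mu.-caratheodory B) /\
  (forall A : set X, exists B : set X,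
    [/\ borel_sets B, A `<=` B & mu B = mu A]).

Definition locally_finite_measure (R : realType) (X : topologicalType)
    (mu : {outer_measure set X -> \bar R}) : Prop :=
  forall x : X, exists2 U : set X, nbhs x U & (mu U < +oo)%E.

Definition metric_measure_space (R : realType) (X : metricType R)
    (mu : {outer_measure set X -> \bar R}) : Prop :=
  [/\ separable_space X, mu [set: X] != 0%E,
      locally_finite_measure mu & borel_regular mu].

Definition doubling (R : realType) (X : metricType R)
    (mu : {outer_measure set X -> \bar R}) : Prop :=
  exists2 C : R, 0 < C & forall (x : X) (r : R), 0 < r ->
    (mu (ball x (2 * r)) <= C%:E * mu (ball x r))%E.

Definition density_zero (R : realType) (X : metricType R)
    (mu : {outer_measure set X -> \bar R}) (A : set X) (x : X) : Prop :=
  (mu (ball x r `&` A) / mu (ball x r))%E @[r --> 0^'+] --> 0%E.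

(* Approximate limsup at x of F, seen as a function on D; the infimum is taken
   in \bar R, so that it is +oo when no real a qualifies. *)
Definition ap_limsup (R : realType) (X : metricType R)
    (mu : {outer_measure set X -> \bar R}) (D : set X) (F : X -> R) (x : X)
    : \bar R :=
  ereal_inf [set a%:E | a in
    [set a : R | density_zero mu [set y | D y /\ a < F y] x]].

Definition locally_lipschitz_on (R : realType) (X : metricType R)
    (G : set X) (f : X -> R) : Prop :=
  forall x, G x -> exists2 U : set X, nbhs x U &
    exists L : R, forall y z, (G `&` U) y -> (G `&` U) z ->
      `|f y - f z| <= L * mdist y z.

(* The structures on [caratheodory_type mu], and hence [measurable_fun] and
   [{ae mu, _}] for the sigma-algebra [mu.-caratheodory], need a pointed
   carrier, which a metricType is not; the next two definitions spell out these
   notions. The measurable subsets of R are the Borel sets. *)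
Definition mu_measurable_fun (R : realType) (X : Type)
    (mu : {outer_measure set X -> \bar R}) (E : set X) (f : X -> R) : Prop :=
  forall Y : set R, measurable Y -> mu.-caratheodory (E `&` f @^-1` Y).

Definition mu_ae_in (R : realType) (X : Type)
    (mu : {outer_measure set X -> \bar R}) (E : set X) (P : X -> Prop) : Prop :=
  mu [set x | E x /\ ~ P x] = 0%E.

(* Main.v *)
Require Import Defs.
From HB Require Import structures.
From mathcomp Require Import all_boot all_order all_algebra.
From mathcomp Require Import all_classical all_reals all_analysis.
From mathcomp Require Import lra.

(** The theorem is a Stepanov-type statement, and both directions rest on the
Lebesgue density theorem for a doubling measure ([density_theorem]): almost
every point of a measurable set [A] is a point of density zero of its
complement.  It is enough to have a weak-type covering estimate for that
([ball_cover_le]).  If the points of density less than one in [A] are covered by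
balls inside an open set [U] that almost coincides with [A], and each of these
balls spends a fixed fraction of its mass in [U \ A], then a greedy disjoint
selection, together with doubling, bounds the mass of the covered set by a
multiple of the mass of [U \ A], which is as small as desired.

From the approximate condition to Lusin approximation: call [x] in [E] good of
order [k] if, on every ball around [x] of radius below [1 / (k + 1)], all but a
fraction [eta] of the mass consists of points [z] of [E] with
[|f z - f x| <= k d(x, z)].  By density, almost every point of [E] is good of
some order ([good_points_cover]).  If [x] and [y] are both good of order [k]
and close, then for small [eta] doubling provides a point [z] near both that is
well behaved with respect to both, so [f] is Lipschitz at small scales on the
good points of order [k] ([good_points_lipschitz]).  The set of good points
need not be measurable.  This is circumvented by first passing to a closed set
[F] on which [f] is continuous ([lusin]): the Lipschitz estimate survives on
the closure in [F] of the good points, and these closures are measurable and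
exhaust [F] up to a null set ([lusin_lipschitz]).  All this is done inside the
annuli [n <= d(a, x) < n + 1], which have finite measure; the closed pieces so
obtained are disjoint and form a locally finite family, so their union is
closed and [f] is still locally Lipschitz on it ([glue_annuli]).

Conversely, at a density point of a closed [G] on which [f] is locally
Lipschitz, the set where the difference quotient exceeds the local Lipschitz
constant lies outside [G] near the point, hence has density zero
([ap_limsup_density]).  Almost every point of [G] is such a point, and
[E \ G] is arbitrarily small. *)

Set Implicit Arguments.
Unset Strict Implicit.
Unset Printing Implicit Defensive.

Import Order.TTheory GRing.Theory Num.Theory.
Import numFieldNormedType.Exports.

Local Open Scope classical_set_scope.
Local Open Scope ring_scope.

(** * Null sets and monotone limits for an outer measure *)

Section CaratheodoryContinuity.
Context (R : realType) (T : Type) (mu : {outer_measure set T -> \bar R}).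
Local Open Scope ereal_scope.

Lemma outer_measure_null (A : set T) :
  (forall e : R, (0 < e)%R -> mu A <= e%:E) -> mu A = 0.
Proof.
move=> h; apply/eqP; rewrite eq_le outer_measure_ge0 andbT.
by apply/lee_addgt0Pr => e e0; rewrite add0e; exact: h.
Qed.

Lemma outer_measure_subnull (A B : set T) : A `<=` B -> mu B = 0 -> mu A = 0.
Proof.
move=> AB B0; apply/eqP; rewrite eq_le outer_measure_ge0 andbT -B0.
exact: le_outer_measure.
Qed.

Lemma outer_measure_bigcup_null (A : (set T)^nat) :
  (forall n, mu (A n) = 0) -> mu (\bigcup_n A n) = 0.
Proof.
move=> A0; apply/eqP; rewrite eq_le outer_measure_ge0 andbT.
apply: le_trans (outer_measure_sigma_subadditive mu A) _.
by rewrite eseries0.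
Qed.

Lemma outer_measure_bigcup_eps (A : (set T)^nat) (e : R) : (0 <= e)%R ->
  (forall n, mu (A n) <= (e / (2 ^ n.+1)%:R)%:E) -> mu (\bigcup_n A n) <= e%:E.
Proof.
move=> e0 Ae; apply: le_trans (outer_measure_sigma_subadditive mu A) _.
apply: le_trans (epsilon_trick0 xpredT e0).
apply: lee_nneseries => [n _ _|n _]; last exact: Ae.
  exact: outer_measure_ge0.
Qed.


(** The Caratheodory sets with [mu] form a measure space as soon as the carrier
is pointed, and a nonempty set provides a point; continuity from below is then
that of a measure. *)
Lemma caratheodory_bigcup_le (F : (set T)^nat) (c : \bar R) :
  (forall n, mu.-caratheodory (F n)) -> nondecreasing_seq F ->
  (forall n, mu (F n) <= c) -> mu (\bigcup_n F n) <= c.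
Proof.
move=> mF ndF Fc.
have [->|/set0P[x0 _]] := eqVneq (\bigcup_n F n) set0.
  by rewrite outer_measure0; apply: le_trans (Fc 0%N); exact: outer_measure_ge0.
pose T' : pointedType :=
  HB.pack T (gen_eqMixin T) (gen_choiceMixin T) (isPointed.Build T x0).
have := @nondecreasing_cvg_mu _ (caratheodory_type (mu : set T' -> _)) R
  mu F mF (caratheodory_measurable_bigcup mF) ndF.
move=> cvF; rewrite -(cvg_lim _ cvF)//.
by apply: lime_le; [apply/cvg_ex; eexists; exact: cvF | exact: nearW].
Qed.

(** Continuity from above, in the form in which it extracts one small set from a
decreasing sequence. *)
Lemma caratheodory_bigcap_eps (F : (set T)^nat) (e : R) :
  mu (F 0%N) < +oo -> (forall n, mu.-caratheodory (F n)) ->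
  nonincreasing_seq F -> mu (\bigcap_n F n) = 0 -> (0 < e)%R ->
  exists n, mu (F n) <= e%:E.
Proof.
move=> F0 mF niF Fcap e0.
have [FE|/set0P[x0 _]] := eqVneq (F 0%N) set0.
  by exists 0%N; rewrite FE outer_measure0 lee_fin ltW.
pose T' : pointedType :=
  HB.pack T (gen_eqMixin T) (gen_choiceMixin T) (isPointed.Build T x0).
have mcap : mu.-caratheodory (\bigcap_n F n).
  rewrite -(setCK (\bigcap_n F n)) setC_bigcap.
  apply: caratheodory_measurable_setC; apply: caratheodory_measurable_bigcup => n.
  exact: caratheodory_measurable_setC.
have := @nonincreasing_cvg_mu _ (caratheodory_type (mu : set T' -> _)) R
  mu F F0 mF mcap niF.
move=> cvF; apply/not_existsP => Fe.
suff : e%:E <= 0 by rewrite lee_fin leNgt e0.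
rewrite -[leRHS]Fcap -[leRHS](cvg_lim _ cvF)//.
apply: lime_ge; first by apply/cvg_ex; eexists; exact: cvF.
by apply: nearW => n; rewrite ltW// ltNge; apply/negP/Fe.
Qed.

End CaratheodoryContinuity.

(** * Balls and closures in a metric space *)

Section MetricTopology.
Context (R : realType) (X : metricType R).

Lemma in_ball (x y : X) (r : R) : ball x r y = (mdist x y < r) :> Prop.
Proof. by rewrite ballEmdist. Qed.

Lemma metric_openP (A : set X) :
  open A <-> forall x, A x -> exists2 r, 0 < r & ball x r `<=` A.
Proof.
rewrite openE; split=> h x Ax; first by have /nbhs_ballP[r] := h x Ax; exists r.
by apply/nbhs_ballP; have [r] := h x Ax; exists r.
Qed.

Lemma metric_ball_open (x : X) (r : R) : open (ball x r).
Proof.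
apply/metric_openP => y; rewrite in_ball => xy.
exists (r - mdist x y); first by rewrite subr_gt0.
move=> z; rewrite !in_ball => yz.
by have := metric_triangle x y z; lra.
Qed.

Lemma ball_subset (x y : X) (r s : R) :
  mdist x y + r <= s -> ball y r `<=` ball x s.
Proof.
move=> h z; rewrite !in_ball => yz.
by have := metric_triangle x y z; lra.
Qed.

Lemma metric_closure (A : set X) (x : X) (r : R) :
  closure A x -> 0 < r -> exists2 y, A y & mdist x y < r.
Proof.
move=> clA r0; have [y [Ay]] := clA _ (nbhsx_ballx x r r0).
by rewrite in_ball; exists y.
Qed.

Lemma closed_ball_avoid (A : set X) (x : X) : closed A -> ~ A x ->
  exists2 r, 0 < r & forall y, ball x r y -> ~ A y.
Proof.
by move=> /closed_openC/metric_openP /(_ x) h /h[r r0 rA]; exists r.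
Qed.

Definition inner_layer (B : set X) (n : nat) : set X :=
  [set x | forall y, ~ B y -> n.+1%:R^-1 <= mdist x y].

(** The layers exhaust an open set by closed sets, so open sets are
countable unions of closed sets. *)
Lemma closed_inner_layer (B : set X) (n : nat) : closed (inner_layer B n).
Proof.
rewrite -openC; apply/metric_openP => x /existsNP[y /not_implyP[By]].
move=> /negP; rewrite -ltNge => xy.
exists (n.+1%:R^-1 - mdist x y); first by rewrite subr_gt0.
move=> z; rewrite in_ball => xz /(_ y By) zy.
move: xz; rewrite ltrBrDr (metric_sym x z) => xz.
by have := le_lt_trans (metric_triangle z x y) xz; rewrite ltNge zy.
Qed.

Lemma inner_layer_sub (B : set X) (n : nat) : inner_layer B n `<=` B.
Proof.
move=> x Bx; apply: contrapT => nBx; have := Bx x nBx.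
by rewrite mdistxx leNgt invr_gt0 ltr0n.
Qed.

Lemma bigcup_inner_layer (B : set X) :
  open B -> B `<=` \bigcup_n inner_layer B n.
Proof.
move=> /metric_openP oB x /oB[r r0 rB].
have [n] := ltr_add_invr r0; rewrite add0r => nr.
exists n => // y By; rewrite leNgt; apply/negP => xy; apply: By; apply: rB.
by rewrite in_ball; exact: lt_trans nr.
Qed.

Lemma nondecreasing_inner_layer (B : set X) : nondecreasing_seq (inner_layer B).
Proof.
move=> m n mn; apply/subsetPset => x h y /h; apply: le_trans.
by rewrite lef_pV2 ?posrE ?ltr0n// ler_nat ltnS.
Qed.

End MetricTopology.

(** * Approximation by open and closed sets *)

Lemma borel_setD (X : topologicalType) (A B : set X) :
  borel_sets A -> borel_sets B -> borel_sets (A `\` B).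
Proof.
move=> bA bB; have [b0 bC bU] := @smallest_sigma_algebra X setT (@open X).
 rewrite -[A `\` B]setCK setDE setCI setCK -setTD; apply: (bC).
rewrite -bigcup2E; apply: bU => -[|[|n]] //=.
by rewrite -setTD; apply: bC.
Qed.

Section BorelRegular.
Context (R : realType) (X : metricType R) (mu : {outer_measure set X -> \bar R}).
Hypothesis borel_cara : forall B : set X, borel_sets B -> mu.-caratheodory B.
Hypothesis borel_hull : forall A : set X, exists B : set X,
    [/\ borel_sets B, A `<=` B & mu B = mu A].

Lemma open_caratheodory (U : set X) : open U -> mu.-caratheodory U.
Proof. by move=> oU; apply: borel_cara; exact: sub_sigma_algebra. Qed.

Lemma closed_caratheodory (F : set X) : closed F -> mu.-caratheodory F.
Proof.
move=> /closed_openC/open_caratheodory/caratheodory_measurable_setC.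
by rewrite setCK.
Qed.

(** The measure is only tested inside [O], which will have finite measure, so that
continuity from above applies. *)
Definition sandwiched (O B : set X) := forall e : R, 0 < e ->
  exists F U, [/\ closed F, open U, F `<=` B, B `<=` U &
    (mu ((U `\` F) `&` O) <= e%:E)%E].

Lemma sandwiched_open (O B : set X) : open O -> (mu O < +oo)%E -> open B ->
  sandwiched O B.
Proof.
move=> oO Ofin oB e e0.
(* The layers increase to [B], so what they miss inside [O] decreases to the empty set. *)
pose D n := (B `\` inner_layer B n) `&` O.
have [| | | | n nD] := @caratheodory_bigcap_eps _ _ mu D e _ _ _ _ e0.
- by apply: le_lt_trans Ofin; apply: le_outer_measure => x [].
- move=> n; apply: caratheodory_measurable_setI; last exact: open_caratheodory.
  apply: caratheodory_measurable_setD; first exact: open_caratheodory.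
  exact/closed_caratheodory/closed_inner_layer.
- move=> m n mn; apply/subsetPset => x [[Bx nx] Ox]; split=> //; split=> // mx.
  by apply: nx; move/subsetPset: (nondecreasing_inner_layer B mn); apply.
- rewrite (_ : bigcap _ _ = set0) ?outer_measure0// -subset0 => x /= Dx.
  have [[Bx _] _] := Dx 0%N I.
  have [n _ nx] := bigcup_inner_layer oB Bx.
  by have [[_ /(_ nx)]] := Dx n I.
exists (inner_layer B n), B; split => //.
- exact: closed_inner_layer.
- exact: inner_layer_sub.
Qed.

Lemma sandwichedC (O B : set X) : sandwiched O B -> sandwiched O (~` B).
Proof.
move=> h e /h[F [U [cF oU FB BU UF]]]; exists (~` U), (~` F); split.
- exact: open_closedC.
- exact: closed_openC.
- exact: subsetC.
- exact: subsetC.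
- by rewrite [~` F `\` _]setDE setCK [~` F `&` U]setIC -setDE.
Qed.

(** The inner sets are closed only for finite unions, so the union of all of them is
truncated; continuity from above controls what the truncation loses. *)
Lemma sandwiched_bigcup (O : set X) (B : (set X)^nat) : open O ->
  (mu O < +oo)%E -> (forall n, sandwiched O (B n)) ->
  sandwiched O (\bigcup_n B n).
Proof.
move=> oO Ofin h e e0.
have /choice[FU FUP] n : exists FU : set X * set X,
    [/\ closed FU.1, open FU.2, FU.1 `<=` B n, B n `<=` FU.2 &
    (mu ((FU.2 `\` FU.1) `&` O) <= (e / 2 / (2 ^ n.+1)%:R)%:E)%E].
  have [|F [U ?]] := h n (e / 2 / (2 ^ n.+1)%:R); last by exists (F, U).
  by rewrite !divr_gt0// ltr0n expn_gt0.
pose F n := (FU n).1; pose U n := (FU n).2.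
have cF n : closed (F n) by have [] := FUP n.
pose S n := \bigcup_(k in `I_n) F k.
pose D n := (\bigcup_k F k `\` S n) `&` O.
have cS n : closed (S n) by apply: closed_bigcup => [|i _] //; exact: finite_II.
have e20 : 0 < e / 2 by rewrite divr_gt0.
have [| | | | n nD] := @caratheodory_bigcap_eps _ _ mu D _ _ _ _ _ e20.
- by apply: le_lt_trans Ofin; apply: le_outer_measure => x [].
- move=> n; apply: caratheodory_measurable_setI; last exact: open_caratheodory.
  apply: caratheodory_measurable_setD; last exact/closed_caratheodory.
  by apply: caratheodory_measurable_bigcup => k; exact/closed_caratheodory.
- move=> m n mn; apply/subsetPset => x [[Bx nx] Ox]; split=> //; split=> //.
  by move=> [k /= km Fk]; apply: nx; exists k => //=; exact: leq_trans mn.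
- rewrite (_ : bigcap _ _ = set0) ?outer_measure0// -subset0 => x /= Dx.
  have [[[n _ nx] _] _] := Dx 0%N I.
  have [[_ + _]] := Dx n.+1 I; apply; exists n => //=.
exists (S n), (\bigcup_k U k); split => //.
- by apply: bigcup_open => k _; have [] := FUP k.
- by move=> x [k _ Fx]; exists k => //; have [_ _ + _ _] := FUP k; apply.
- by move=> x [k _ Bx]; exists k => //; have [_ _ _ + _] := FUP k; apply.
pose V := \bigcup_k ((U k `\` F k) `&` O).
have Ve : (mu V <= (e / 2)%:E)%E.
  by apply: outer_measure_bigcup_eps; [exact: ltW|move=> k; have [] := FUP k].
apply: (@le_trans _ _ (mu (V `|` D n))).
  apply: le_outer_measure => x [[[k _ Ux] Sx] Ox].
  have [Fx|Fx] := pselect ((\bigcup_k F k) x); first by right.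
  by left; exists k => //; split=> //; split=> // Fkx; apply: Fx; exists k.
apply: le_trans (outer_measureU2 mu V (D n)) _.
by rewrite [e in leRHS]splitr EFinD leeD.
Qed.

(** The sets that are sandwiched form a sigma-algebra containing the open sets. *)
Lemma sandwiched_borel (O B : set X) : open O -> (mu O < +oo)%E ->
  borel_sets B -> sandwiched O B.
Proof.
move=> oO Ofin; apply: (smallest_sub (X := sandwiched O)).
  split=> [|A|A hA].
  - by apply: sandwiched_open => //; exact: open0.
  - by rewrite setTD; exact: sandwichedC.
  - exact: sandwiched_bigcup.
by move=> A oA; exact: sandwiched_open.
Qed.

(** Splitting the hull along a measurable set of finite measure leaves no mass
outside it; Borel regularity thus extends the approximation of Borel sets to all
measurable sets. *)
Lemma hull_null (A B : set X) : mu.-caratheodory A -> A `<=` B -> mu B = mu A ->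
  (mu A < +oo)%E -> mu (B `\` A) = 0%E.
Proof.
move=> mA AB BA Afin; have := mA B.
rewrite BA (setIidr AB) -setDE => BE.
have fA : mu A \is a fin_num by rewrite ge0_fin_numE// outer_measure_ge0.
by rewrite -[LHS](addeK _ fA) [(_ + mu A)%E]addeC -BE subee.
Qed.

Lemma caratheodory_open_approx (O A : set X) (e : R) : open O ->
  (mu O < +oo)%E -> mu.-caratheodory A -> A `<=` O -> 0 < e ->
  exists U, [/\ open U, A `<=` U & (mu (U `\` A) <= e%:E)%E].
Proof.
move=> oO Ofin mA AO e0.
have Afin : (mu A < +oo)%E by apply: le_lt_trans Ofin; exact: le_outer_measure.
have [B [bB AB BA]] := borel_hull A.
have [F [U [cF oU FB BU UF]]] := sandwiched_borel oO Ofin bB e0.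
exists (U `&` O); split; first exact: openI.
  by move=> x Ax; split; [exact/BU/AB|exact: AO].
apply: (@le_trans _ _ (mu (((U `\` F) `&` O) `|` (B `\` A)))).
  apply: le_outer_measure => x [[Ux Ox] Ax].
  have [Bx|Bx] := pselect (B x); first by right.
  by left; split=> //; split=> // /FB.
apply: le_trans (outer_measureU2 _ _ _) _.
by rewrite (hull_null mA AB BA Afin) adde0.
Qed.

(** Inner approximation comes from a Borel hull [B] of [O \ A]: the Borel set
[O \ B] lies in [A] and differs from it by a null set. *)
Lemma caratheodory_closed_approx (O A : set X) (e : R) : open O ->
  (mu O < +oo)%E -> mu.-caratheodory A -> A `<=` O -> 0 < e ->
  exists F, [/\ closed F, F `<=` A & (mu (A `\` F) <= e%:E)%E].
Proof.
move=> oO Ofin mA AO e0.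
have mOA : mu.-caratheodory (O `\` A).
  by apply: caratheodory_measurable_setD => //; exact: open_caratheodory.
have OAfin : (mu (O `\` A) < +oo)%E.
  by apply: le_lt_trans Ofin; apply: le_outer_measure => x [].
have [B [bB AB BA]] := borel_hull (O `\` A).
have bOB : borel_sets (O `\` B).
  by apply: borel_setD => //; exact: sub_sigma_algebra.
have [F [U [cF oU FOB OBU UF]]] := sandwiched_borel oO Ofin bOB e0.
exists F; split => //.
  by move=> x /FOB[Ox nBx]; apply: contrapT => nAx; apply/nBx/AB.
apply: (@le_trans _ _ (mu (((U `\` F) `&` O) `|` (B `\` (O `\` A))))).
  apply: le_outer_measure => x [Ax Fx]; have Ox := AO _ Ax.
  have [Bx|Bx] := pselect (B x); first by right; split=> // -[].
  by left; split=> //; split=> //; exact: OBU.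
apply: le_trans (outer_measureU2 _ _ _) _.
by rewrite (hull_null mOA AB BA OAfin) adde0.
Qed.

End BorelRegular.

(** * Balls of a doubling measure *)

Lemma metric_measure_nonempty (R : realType) (X : metricType R)
    (mu : {outer_measure set X -> \bar R}) :
  metric_measure_space mu -> [set: X] !=set0.
Proof.
move=> [_ muX0 _ _]; apply/set0P; apply: contra_neq muX0 => ->.
by rewrite outer_measure0.
Qed.

Section Doubling.
Context (R : realType) (X : metricType R) (mu : {outer_measure set X -> \bar R}).
Hypotheses (Xmu : metric_measure_space mu) (dmu : doubling mu).

Lemma doubling_iter : exists2 C : R, 0 < C & forall (x : X) (r : R) (n : nat),
  0 < r -> (mu (ball x (2 ^+ n * r)) <= (C ^+ n)%:E * mu (ball x r))%E.
Proof.
have [C C0 hC] := dmu; exists C => // x r n r0.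
elim: n => [|n IHn]; first by rewrite !expr0 mul1r mul1e.
rewrite !exprS -mulrA EFinM -muleA.
apply: le_trans (hC _ _ _) _; first by rewrite mulr_gt0// exprn_gt0.
by apply: lee_wpmul2l; rewrite // lee_fin ltW.
Qed.

Lemma exists_dilation (r s : R) : 0 < r -> exists n : nat, s < 2 ^+ n * r.
Proof.
move=> r0; exists (Num.truncn (s / r)).+1; rewrite -ltr_pdivrMr//.
apply: lt_trans (truncnS_gt _) _.
by rewrite -natrX ltr_nat ltn_expl.
Qed.

(** Some small ball at [x] has finite measure, and doubling propagates finiteness to
all radii. *)
Lemma mu_ball_fin (x : X) (r : R) : (mu (ball x r) < +oo)%E.
Proof.
have [_ _ lf _] := Xmu; have [U /nbhs_ballP[e /= e0 eU] Ufin] := lf x.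
have [n rn] := exists_dilation r e0; have [C C0 hC] := doubling_iter.
have efin : (mu (ball x e) < +oo)%E.
  by apply: le_lt_trans Ufin; exact: le_outer_measure.
apply: (@le_lt_trans _ _ (mu (ball x (2 ^+ n * e)))).
  by apply: le_outer_measure; apply: ball_subset; rewrite mdistxx add0r ltW.
apply: le_lt_trans (hC _ _ _ e0) _.
by rewrite lte_mul_pinfty// ?ge0_fin_numE// lee_fin exprn_ge0// ltW.
Qed.

(** A null ball would, by doubling, make all its dilations null, and these exhaust
the space. *)
Lemma mu_ball_gt0 (x : X) (r : R) : 0 < r -> (0 < mu (ball x r))%E.
Proof.
move=> r0; rewrite lt0e outer_measure_ge0 andbT; apply/eqP => xr0.
have [_ /eqP X0 _ _] := Xmu; have [C C0 hC] := doubling_iter.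
apply: X0; apply: (@outer_measure_subnull _ _ _ _ (\bigcup_n ball x (2 ^+ n * r))).
  move=> y _; have [n yn] := exists_dilation (mdist x y) r0.
  by exists n => //; rewrite in_ball.
apply: outer_measure_bigcup_null => n; apply/eqP.
by rewrite eq_le outer_measure_ge0 andbT (le_trans (hC _ _ _ r0))// xr0 mule0.
Qed.

(** The factor 4 serves both the greedy selection of balls and the comparison of
balls around two nearby good points. *)
Lemma doubling_quadruple : exists2 K : R, 0 < K & forall (x : X) (r : R),
  0 < r -> (mu (ball x (4 * r)) <= K%:E * mu (ball x r))%E.
Proof.
have [C C0 hC] := doubling_iter; exists (C ^+ 2); first exact: exprn_gt0.
move=> x r r0; have := hC x r 2 r0.
by rewrite (_ : 2 ^+ 2 = 4)// expr2 -natrM.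
Qed.

Lemma fine_mu_ball_gt0 (x : X) (r : R) : 0 < r -> 0 < fine (mu (ball x r)).
Proof. by move=> r0; rewrite fine_gt0// mu_ball_gt0// mu_ball_fin. Qed.

Lemma fineK_mu_ball (x : X) (r : R) :
  (fine (mu (ball x r)))%:E = mu (ball x r).
Proof. by rewrite fineK// ge0_fin_numE ?mu_ball_fin// outer_measure_ge0. Qed.

(** As balls have positive and finite measure, the quotient can be cleared of its
denominator. *)
Lemma density_zeroP (A : set X) (x : X) : density_zero mu A x <->
  forall e : R, 0 < e -> exists2 d : R, 0 < d & forall r, 0 < r -> r < d ->
    (mu (ball x r `&` A) <= e%:E * mu (ball x r))%E.
Proof.
pose g (r : R) : R := fine (mu (ball x r `&` A)) / fine (mu (ball x r)).
have fA r : (fine (mu (ball x r `&` A)))%:E = mu (ball x r `&` A).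
  rewrite fineK// ge0_fin_numE ?outer_measure_ge0//.
  by apply: le_lt_trans (mu_ball_fin x r); apply: le_outer_measure => y [].
have gE r : 0 < r -> (mu (ball x r `&` A) / mu (ball x r))%E = (g r)%:E.
  move=> r0; rewrite -fA -fineK_mu_ball inver gt_eqF ?fine_mu_ball_gt0//.
have g0 r : 0 <= g r by rewrite divr_ge0// fine_ge0// outer_measure_ge0.
have gP r e : 0 < r -> (g r <= e) = (mu (ball x r `&` A) <= e%:E * mu (ball x r))%E.
  move=> r0; rewrite -fA -fineK_mu_ball -EFinM lee_fin.
  by rewrite ler_pdivrMr// fine_mu_ball_gt0.
have in0 d r : 0 < r -> (ball_ (fun x : R => `|x|) 0 d r) = (r < d) :> Prop.
  by move=> r0; rewrite /ball_/= sub0r normrN gtr0_norm.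
rewrite /density_zero; split.
  move=> /fine_cvgP[_ /cvgr0Pnorm_le h] e e0.
  have [d /= d0 hd] := h e e0; exists d => // r r0 rd.
  rewrite -gP//; have := hd r; rewrite in0// => /(_ rd r0) /=.
  by rewrite gE//= ger0_norm.
move=> h; apply/fine_cvgP; split.
  by near=> r; rewrite gE//; near: r; exact: nbhs_right_gt.
apply/cvgr0Pnorm_le => e e0; have [d d0 hd] := h e e0.
exists d => //= r /[swap] r0; rewrite in0// => rd.
by rewrite gE//= ger0_norm// gP//; exact: hd.
Unshelve. all: by end_near. Qed.

Lemma density_zero_subset (A B : set X) (x : X) :
  (exists2 d : R, 0 < d & ball x d `&` A `<=` B) ->
  density_zero mu B x -> density_zero mu A x.
Proof.
move=> [d d0 AB] /density_zeroP hB; apply/density_zeroP => e /hB[r r0 hr].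
exists (Num.min d r); first by rewrite lt_min d0.
move=> s s0; rewrite lt_min => /andP[sd sr].
apply: le_trans (hr s s0 sr); apply: le_outer_measure => y [sy Ay].
split=> //; apply: AB; split=> //.
by move: sy; rewrite !in_ball => /lt_trans; apply.
Qed.

End Doubling.

(** * The covering estimate and the density theorem *)

Section Covering.
Context (R : realType) (X : metricType R) (mu : {outer_measure set X -> \bar R}).

Definition ball_union (s : seq (X * R)) : set X :=
  [set y | exists2 p, p \in s & ball p.1 p.2 y].

Lemma max_radius (s : seq (X * R)) : s != [::] ->
  exists2 p, p \in s & forall q, q \in s -> q.2 <= p.2.
Proof.
elim: s => // p s IHs _; have [->|/IHs[q qs qmax]] := eqVneq s [::].
  by exists p; rewrite ?mem_head// => q; rewrite inE => /eqP->.
have [pq|qp] := leP p.2 q.2.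
  exists q; first by rewrite inE qs orbT.
  by move=> t; rewrite inE => /predU1P[->|/qmax].
exists p; first exact: mem_head.
move=> t; rewrite inE => /predU1P[->//|/qmax/le_trans]; apply; exact: ltW.
Qed.

(** Select a ball [B] of maximal radius: its dilation covers all the balls that meet
[B], and the remaining balls, being disjoint from [B], capture a part of [W]
disjoint from the one in [B].  Induction on the remaining balls thus adds up
contributions of disjoint parts of [W], which stands for the additivity of [mu]
over a disjoint subfamily. *)
Lemma greedy_cover_le (K L : R) (W : set X) (s : seq (X * R)) :
  0 <= K -> 0 <= L ->
  (forall U : set X, open U -> mu.-caratheodory U) ->
  (forall (x : X) (r : R), 0 < r ->
    (mu (ball x (4 * r)) <= K%:E * mu (ball x r))%E) ->
  (forall p, p \in s -> 0 < p.2 /\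
    (mu (ball p.1 p.2) <= L%:E * mu (W `&` ball p.1 p.2))%E) ->
  (mu (ball_union s) <= (K * L)%:E * mu (W `&` ball_union s))%E.
Proof.
move=> K0 L0 mU hK.
have KL0 : (0 <= (K * L)%:E)%E by rewrite lee_fin mulr_ge0.
have [n] := ubnP (size s); elim: n s => // n IHn s sn hs.
have [->|s0] := eqVneq s [::].
  rewrite (_ : ball_union [::] = set0) .
    by rewrite setI0 outer_measure0 mule0.
  by rewrite -subset0 => x [].
have [p ps pmax] := max_radius s0; have [p0 pL] := hs _ ps.
pose B := ball p.1 p.2.
pose s' := [seq q <- s | `[< B `&` ball q.1 q.2 = set0 >]].
have s's q : q \in s' -> q \in s by rewrite mem_filter => /andP[].
have size_s' : (size s' < n)%N.
  rewrite -ltnS; apply: leq_ltn_trans sn; rewrite size_filter.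
  rewrite ltn_neqAle count_size andbT -all_count; apply/allPn; exists p => //.
  apply/asboolPn; rewrite setIid -/B => B0.
  suff : B p.1 by rewrite B0.
  by rewrite /B in_ball mdistxx.
have {}IHn := IHn s' size_s' (fun q qs' => hs q (s's q qs')).
have cover : ball_union s `<=` ball p.1 (4 * p.2) `|` ball_union s'.
  move=> y [q qs qy].
  have [Bq|] := pselect (B `&` ball q.1 q.2 = set0).
    by right; exists q => //; rewrite mem_filter qs andbT; exact/asboolP.
  move=> /eqP/set0P[z [pz qz]]; left; rewrite /B !in_ball in pz qz qy *.
  have := metric_triangle p.1 z y; have := metric_triangle z q.1 y.
  by have := pmax _ qs; rewrite (metric_sym z q.1) => qp t1 t2; lra.
have split_mu : (mu (W `&` B) + mu (W `&` ball_union s') <=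
    mu (W `&` ball_union s))%E.
  rewrite (mU B (metric_ball_open _ _) (W `&` ball_union s)).
  apply: leeD; apply: le_outer_measure => y.
    by move=> [Wy By]; split=> //; split=> //; exists p.
  move=> [Wy [q qs' qy]]; split; first by split=> //; exists q => //; exact: s's.
  move: qs'; rewrite mem_filter => /andP[/asboolP Bq _] By.
  by suff : (B `&` ball q.1 q.2) y by rewrite Bq.
apply: le_trans (le_outer_measure mu _ _ cover) _.
apply: le_trans (outer_measureU2 _ _ _) _.
apply: le_trans (lee_wpmul2l KL0 split_mu).
rewrite ge0_muleDr ?outer_measure_ge0//; apply: leeD => //.
apply: le_trans (hK _ _ p0) _; rewrite EFinM -muleA.
exact: lee_wpmul2l.
Qed.

(** A countable base is given by the balls with center in the dense set and radius
[n.+1^-1]; for each of them that fits into a ball of the family, one such ball is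
chosen. *)
Lemma lindelof_balls (Z : set X) (rad : X -> R) : separable_space X ->
  Z !=set0 -> (forall x, Z x -> 0 < rad x) ->
  exists c : nat -> X, (forall k, Z (c k)) /\
    Z `<=` \bigcup_k ball (c k) (rad (c k)).
Proof.
move=> [D [/countable_injP[f finj] Ddense]] [z0 Zz0] rad0.
pose good (p : nat * nat) (x : X) := exists d, [/\ D d, f d = p.1,
  ball d p.2.+1%:R^-1 `<=` ball x (rad x) & Z x].
have /choice[g gP] (p : nat * nat) :
    exists x, Z x /\ ((exists y, good p y) -> good p x).
  have [[y py]|np] := pselect (exists y, good p y); last by exists z0.
  by exists y; split=> //; case: py => d [].
exists (fun k => g (odflt (0%N, 0%N) (unpickle k))).
split=> [k|x Zx]; first by have [] := gP (odflt (0%N, 0%N) (unpickle k)).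
have [n xn] : exists n, n.+1%:R^-1 < rad x / 2.
  by have [|n] := @ltr_add_invr R 0 (rad x / 2);
    [rewrite divr_gt0// rad0|rewrite add0r; exists n].
have n0 : 0 < n.+1%:R^-1 :> R by rewrite invr_gt0.
have [d [xd Dd]] : ball x n.+1%:R^-1 `&` D !=set0.
  apply: Ddense; last exact: metric_ball_open.
  by exists x; rewrite in_ball mdistxx.
move: xd; rewrite in_ball => xd.
have good_x : good (f d, n) x.
  exists d; split=> //; apply: ball_subset => /=.
  by rewrite [rad x]splitr lerD// ltW// (lt_trans xd).
have [_ /(_ (ex_intro _ x good_x))] := gP (f d, n).
move=> [d' [Dd' /= fd' sub _]].
have dd' : d' = d by apply: finj; rewrite ?inE.
exists (pickle (f d, n)) => //; rewrite pickleK/=; apply: sub.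
by rewrite dd' in_ball metric_sym.
Qed.

Hypotheses (Xmu : metric_measure_space mu) (dmu : doubling mu).

(** The greedy estimate is uniform in the number of balls, so it passes to a
countable subcover. *)
Lemma ball_cover_le : exists2 K : R, 0 < K & forall (L : R) (Z W : set X),
  0 <= L ->
  (forall x, Z x -> exists2 r, 0 < r &
    (mu (ball x r) <= L%:E * mu (W `&` ball x r))%E) ->
  (mu Z <= (K * L)%:E * mu W)%E.
Proof.
have [K K0 hK] := doubling_quadruple dmu; exists K => // L Z W L0 hZ.
have [sepX _ _ [bor _]] := Xmu.
have [->|/set0P Z0] := eqVneq Z set0.
  rewrite outer_measure0 mule_ge0 ?outer_measure_ge0//.
  by rewrite lee_fin mulr_ge0// ltW.
have /choice[rad radP] x : exists r, Z x -> 0 < r /\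
    (mu (ball x r) <= L%:E * mu (W `&` ball x r))%E.
  have [/hZ[r ? ?]|nZx] := pselect (Z x); first by exists r.
  by exists 0.
have [c [cZ Zc]] := lindelof_balls sepX Z0 (fun x Zx => (radP x Zx).1).
pose s n := [seq (c k, rad (c k)) | k <- iota 0 n].
apply: (@le_trans _ _ (mu (\bigcup_n ball_union (s n)))).
  apply: le_outer_measure => x /Zc[k _ ckx]; exists k.+1 => //.
  exists (c k, rad (c k)) => //; apply/mapP; exists k => //.
  by rewrite mem_iota/= add0n ltnS.
apply: caratheodory_bigcup_le.
- move=> n; apply: open_caratheodory => //; apply/metric_openP.
  move=> x [p ps px]; have /metric_openP/(_ x px)[r r0 pr] :=
    @metric_ball_open _ X p.1 p.2.
  by exists r => // y /pr py; exists p.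
- move=> m n mn; apply/subsetPset => x [p /mapP[k km ->] kx].
  exists (c k, rad (c k)) => //; apply/mapP; exists k => //.
  by move: km; rewrite !mem_iota/= !add0n => /leq_trans; apply.
move=> n; apply: le_trans (_ : _ <= (K * L)%:E * mu (W `&` ball_union (s n)))%E _.
  apply: greedy_cover_le => //; first exact: ltW.
    by move=> U; exact: open_caratheodory.
  by move=> p /mapP[k _ ->] /=; exact: radP.
apply: lee_wpmul2l; first by rewrite lee_fin mulr_ge0// ltW.
by apply: le_outer_measure => x [].
Qed.

(** In a bounded part of [A], the points around which arbitrarily small balls spend a
fraction [m.+1^-1] of their mass outside [A] have measure at most a constant times
the excess of an open neighborhood, which can be made small. *)
Lemma density_theorem (A : set X) : mu.-caratheodory A ->
  mu [set x | A x /\ ~ density_zero mu (~` A) x] = 0%E.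
Proof.
move=> mA; have [_ _ _ [bor hull]] := Xmu.
have [a _] := metric_measure_nonempty Xmu.
(* The index [n] localizes to a ball, [m] fixes the fraction of mass outside [A]. *)
pose Z (n m : nat) := [set x | [/\ A x, ball a n%:R x &
  forall d : R, 0 < d -> exists2 r, 0 < r < d &
   (m.+1%:R^-1%:E * mu (ball x r) < mu (ball x r `&` ~` A))%E]].
apply: (@outer_measure_subnull _ _ _ _ (\bigcup_n \bigcup_m Z n m)).
  move=> x [Ax /density_zeroP] => /(_ Xmu dmu) /existsNP[e /not_implyP[e0 he]].
  have [m me] := ltr_add_invr e0; rewrite add0r in me.
  exists (Num.truncn (mdist a x)).+1 => //; exists m => //; split=> //.
    by rewrite in_ball truncnS_gt.
  move=> d d0; apply/not_exists2P => hd; apply: he; exists d => // r r0 rd.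
  have [|/negP] := hd r; first by rewrite r0 rd.
  rewrite -leNgt => /le_trans; apply; apply: lee_wpmul2r => //.
    exact: outer_measure_ge0.
  by rewrite lee_fin ltW.
apply: outer_measure_bigcup_null => n; apply: outer_measure_bigcup_null => m.
have [K K0 cov] := ball_cover_le.
have obO : open (ball a n%:R) by exact: metric_ball_open.
have mAO : mu.-caratheodory (A `&` ball a n%:R).
  by apply: caratheodory_measurable_setI => //; exact: open_caratheodory.
have Km0 : 0 < K * m.+1%:R by rewrite mulr_gt0.
apply: outer_measure_null => e e0.
have [||U [oU AU Ue]] := @caratheodory_open_approx _ _ _ bor hull (ball a n%:R) _
  (e / (K * m.+1%:R)) obO (mu_ball_fin Xmu dmu _ _) mAO.
- by move=> x [].
- by rewrite divr_gt0.
apply: (@le_trans _ _ ((K * m.+1%:R)%:E * mu (U `\` (A `&` ball a n%:R)))%E).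
  apply: cov => // x [Ax ox hx].
  have /metric_openP/(_ x (AU _ (conj Ax ox)))[d d0 dU] := oU.
  have [r /andP[r0 rd] hr] := hx d d0; exists r => //.
  rewrite -lee_pdivrMl//; apply: ltW; apply: lt_le_trans hr _.
  apply: le_outer_measure => y [ry Ay]; split=> //; split; last by case.
  by apply: dU; move: ry; rewrite !in_ball => /lt_trans; apply.
apply: (@le_trans _ _ ((K * m.+1%:R)%:E * (e / (K * m.+1%:R))%:E)%E).
  by apply: lee_wpmul2l => //; rewrite lee_fin ltW.
by rewrite -EFinM mulrC divfK// gt_eqF.
Qed.

End Covering.

(** * Lusin approximation *)

Section Lusin.
Context (R : realType) (X : metricType R) (mu : {outer_measure set X -> \bar R}).
Hypothesis bor : forall B : set X, borel_sets B -> mu.-caratheodory B.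
Hypothesis hull : forall A : set X, exists B : set X,
    [/\ borel_sets B, A `<=` B & mu B = mu A].

(** An enumeration of the intervals with rational end points, a countable base of
the line. *)
Definition rat_itv (k : nat) : set R :=
  let p : rat * rat := odflt (0, 0) (unpickle k) in
  [set` `]ratr p.1, ratr p.2[%R].

(** For every basic interval [I], the parts of [A] inside and outside the preimage of
[I] are replaced by closed subsets, at a cost summable over [I].  On what remains,
the preimage of [I] is relatively open as its complement is closed. *)
Lemma lusin (O A : set X) (f : X -> R) (e : R) : open O -> (mu O < +oo)%E ->
  mu.-caratheodory A -> A `<=` O -> mu_measurable_fun mu A f -> 0 < e ->
  exists F, [/\ closed F, F `<=` A, (mu (A `\` F) <= e%:E)%E &
    forall x eta, F x -> 0 < eta -> exists2 d, 0 < d &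
      forall y, F y -> mdist x y < d -> `|f y - f x| < eta].
Proof.
move=> oO Ofin mA AO mf e0.
pose P k := A `&` f @^-1` rat_itv k.
have mP k : mu.-caratheodory (P k) by apply: mf; exact: measurable_itv.
have e_gt0 k : 0 < e / 2 / (2 ^ k.+1)%:R by rewrite !divr_gt0// ltr0n expn_gt0.
have /choice[K KP] k : exists K, [/\ closed K, K `<=` P k &
    (mu (P k `\` K) <= (e / 2 / (2 ^ k.+1)%:R)%:E)%E].
  by apply: (caratheodory_closed_approx bor hull oO) => // x [/AO].
have /choice[K' K'P] k : exists K, [/\ closed K, K `<=` A `\` P k &
    (mu ((A `\` P k) `\` K) <= (e / 2 / (2 ^ k.+1)%:R)%:E)%E].
  apply: (caratheodory_closed_approx bor hull oO) => //.
    exact: caratheodory_measurable_setD.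
  by move=> x [/AO].
pose F := \bigcap_k (K k `|` K' k); exists F; split.
- apply: closed_bigI => k _; apply: closedU.
    by have [] := KP k.
  by have [] := K'P k.
- move=> x /(_ 0%N I)[].
    by have [_ + _] := KP 0%N => /[apply] -[].
  by have [_ + _] := K'P 0%N => /[apply] -[].
- pose D k := (P k `\` K k) `|` ((A `\` P k) `\` K' k).
  apply: (@le_trans _ _ (mu (\bigcup_k D k))).
    apply: le_outer_measure => x [Ax].
    move=> /existsNP[k /not_implyP[_ /not_orP[Kx K'x]]]; exists k => //.
    by have [Px|Px] := pselect (P k x); [left|right].
  apply: outer_measure_bigcup_eps => [|k]; first exact: ltW.
  apply: le_trans (outer_measureU2 _ _ _) _.
  rewrite [e]splitr mulrDl EFinD.
  by have [_ _ ?] := KP k; have [_ _ ?] := K'P k; exact: leeD.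
move=> x eta Fx eta0.
have [p /andP[p1 p2]] : exists p, f x - eta < ratr p < f x.
  by have [|p] := @rat_in_itvoo R (f x - eta) (f x);
    [rewrite ltrBlDr ltrDl|rewrite in_itv/=; exists p].
have [q /andP[q1 q2]] : exists q, f x < ratr q < f x + eta.
  by have [|q] := @rat_in_itvoo R (f x) (f x + eta);
    [rewrite ltrDl|rewrite in_itv/=; exists q].
have itvE z : rat_itv (pickle (p, q)) z = (ratr p < z < ratr q) :> Prop.
  by rewrite /rat_itv pickleK/= in_itv.
set k := pickle (p, q) in itvE.
have [_ KPk _] := KP k; have [cK' K'Pk _] := K'P k.
have fxk : rat_itv k (f x) by rewrite itvE p2.
have nK'x : ~ K' k x by move=> /K'Pk[Ax]; apply; split.
have [d d0 dK'] := closed_ball_avoid cK' nK'x.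
exists d => // y Fy xy; have [/KPk[_]|K'y] := Fy k I.
  by rewrite /= itvE => /andP[yp yq]; rewrite ltr_norml; apply/andP; split; lra.
by exfalso; apply: (dK' y) => //; rewrite in_ball.
Qed.

Definition small_scale_lipschitz (G : set X) (f : X -> R) := exists L rho : R,
  [/\ 0 <= L, 0 < rho & forall x y, G x -> G y -> mdist x y < rho ->
    `|f x - f y| <= L * mdist x y].

(** Both sides of the Lipschitz inequality are continuous on [F], hence the inequality
passes to limits of points of [F] in [S]; the strict bound on the distance is
kept by points close enough to the limits. *)
Lemma small_scale_lipschitz_closure (F S : set X) (f : X -> R) :
  (forall x eta, F x -> 0 < eta -> exists2 d, 0 < d &
      forall y, F y -> mdist x y < d -> `|f y - f x| < eta) ->
  small_scale_lipschitz S f ->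
  small_scale_lipschitz (F `&` closure (F `&` S)) f.
Proof.
move=> cf [L [rho [L0 rho0 hL]]]; exists L, rho; split=> //.
move=> x y [Fx clx] [Fy cly] xy; apply/ler_addgt0Pr => eta eta0.
have eta40 : 0 < eta / 4 by rewrite divr_gt0.
have [dx dx0 hx] := cf x _ Fx eta40; have [dy dy0 hy] := cf y _ Fy eta40.
have L10 : 0 < L + 1 by rewrite ltr_wpDl.
(* [t] is how close to [x] and [y] the approximating points are taken: within the
   moduli of continuity, within half of the slack in [mdist x y < rho], and such
   that [L * t <= eta / 4]. *)
pose t := Num.min (Num.min dx dy) (Num.min ((rho - mdist x y) / 2) (eta / 4 / (L + 1))).
have t0 : 0 < t by rewrite !lt_min dx0 dy0 !divr_gt0// subr_gt0.
have [tdx tdy trho teta] :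
    [/\ t <= dx, t <= dy, t <= (rho - mdist x y) / 2 & t <= eta / 4 / (L + 1)].
  by split; rewrite !ge_min lexx ?orbT.
have [x' [Fx' Sx'] xx'] := metric_closure clx t0.
have [y' [Fy' Sy'] yy'] := metric_closure cly t0.
have fxx' := hx x' Fx' (lt_le_trans xx' tdx).
have fyy' := hy y' Fy' (lt_le_trans yy' tdy).
have dxy' : mdist x' y' < mdist x y + 2 * t.
  have := metric_triangle x' x y'; have := metric_triangle x y y'.
  by rewrite (metric_sym x' x); lra.
have Lt : L * t <= eta / 4.
  by move: teta; rewrite ler_pdivlMr// => teta; nra.
have fxy' : `|f x' - f y'| <= L * mdist x' y' by apply: hL => //; lra.
have Ld : L * mdist x' y' <= L * (mdist x y + 2 * t) by rewrite ler_wpM2l// ltW.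
have -> : f x - f y = - (f x' - f x) + (f x' - f y') + (f y' - f y) by lra.
apply: le_trans (ler_normD _ _) _.
have := ler_normD (- (f x' - f x)) (f x' - f y'); rewrite normrN.
by move: fxx' fyy' Ld; lra.
Qed.

(** The sets [S k] may fail to be measurable; their relative closures in the closed
set [F] replace them. *)
Lemma lusin_lipschitz (O A : set X) (f : X -> R) (S : (set X)^nat) (e : R) :
  open O -> (mu O < +oo)%E -> mu.-caratheodory A -> A `<=` O ->
  mu_measurable_fun mu A f -> nondecreasing_seq S ->
  (forall k, small_scale_lipschitz (S k) f) ->
  mu (A `\` \bigcup_k S k) = 0%E -> 0 < e ->
  exists G, [/\ closed G, G `<=` A, (mu (A `\` G) <= e%:E)%E &
    small_scale_lipschitz G f].
Proof.
move=> oO Ofin mA AO mf ndS lipS AS e0; have e20 : 0 < e / 2 by rewrite divr_gt0.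
have [F [cF FA AF fF]] := lusin oO Ofin mA AO mf e20.
pose G k := F `&` closure (F `&` S k).
have cG k : closed (G k) by apply: closedI => //; exact: closed_closure.
have [| | | |k GK] := @caratheodory_bigcap_eps _ _ mu (fun k => F `\` G k) _ _ _ _ _ e20.
- by apply: le_lt_trans Ofin; apply: le_outer_measure => x [/FA/AO].
- by move=> k; apply: caratheodory_measurable_setD; exact: closed_caratheodory.
- move=> m n mn; apply/subsetPset => x [Fx Gx]; split=> // -[_ clx]; apply: Gx.
  split=> //; move: clx; apply: closure_subset; apply: setIS.
  exact/subsetPset/ndS.
- apply: outer_measure_subnull AS => x Dx; have [Fx _] := Dx 0%N I.
  split; first exact: FA.
  move=> [k _ Skx]; have [_] := Dx k I; apply; split=> //.
  by apply: subset_closure.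
exists (G k); split=> //.
- by move=> x [/FA].
- apply: (@le_trans _ _ (mu ((A `\` F) `|` (F `\` G k)))).
    apply: le_outer_measure => x [Ax Gx].
    by have [Fx|Fx] := pselect (F x); [right|left].
  apply: le_trans (outer_measureU2 _ _ _) _.
  by rewrite [e]splitr EFinD; exact: leeD.
exact: small_scale_lipschitz_closure.
Qed.

End Lusin.

(** * Locally finite unions of closed pieces *)

Section Gluing.
Context (R : realType) (X : metricType R).

(** Only finitely many [G n] come near [x], and each of those that does not contain
[x] stays at positive distance from it. *)
Lemma locally_finite_closed (a : X) (G : (set X)^nat) (x : X) :
  (forall n, closed (G n)) -> (forall n y, G n y -> n%:R <= mdist a y) ->
  exists2 d : R, 0 < d & forall n y, ball x d y -> G n y -> G n x.
Proof.
move=> cG aG.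
have fin N : exists2 d : R, 0 < d &
    forall n y, (n < N)%N -> ball x d y -> G n y -> G n x.
  elim: N => [|N [d d0 hd]]; first by exists 1.
  have [GNx|GNx] := pselect (G N x).
    exists d => // n y; rewrite ltnS leq_eqVlt => /predU1P[->//|]; exact: hd.
  have [r r0 rG] := closed_ball_avoid (cG N) GNx.
  exists (Num.min d r); first by rewrite lt_min d0.
  move=> n y; rewrite in_ball lt_min ltnS leq_eqVlt => /predU1P nN /andP[yd yr].
  case: nN => [->|nN]; first by move=> /rG; case; rewrite in_ball.
  by apply: hd; rewrite ?in_ball.
pose N := (Num.truncn (mdist a x + 1)).+1; have [d d0 hd] := fin N.
exists (Num.min d 1); first by rewrite lt_min d0/=.
move=> n y; rewrite in_ball lt_min => /andP[yd y1] Gy.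
have [nN|Nn] := ltnP n N; first by apply: (hd n y); rewrite ?in_ball.
have ax : mdist a x + 1 < N%:R by exact: truncnS_gt.
have Nn' : N%:R <= n%:R :> R by rewrite ler_nat.
by have := aG n y Gy; have := metric_triangle a x y; lra.
Qed.

(** The pieces are disjoint, so near a point of one piece no other piece is visible.
This is why the Lipschitz constants and scales may depend on the piece. *)
Lemma glue_annuli (a : X) (G : (set X)^nat) (f : X -> R) :
  (forall n, closed (G n)) ->
  (forall n, G n `<=` ball a n.+1%:R `\` ball a n%:R) ->
  (forall n, small_scale_lipschitz (G n) f) ->
  closed (\bigcup_n G n) /\ locally_lipschitz_on (\bigcup_n G n) f.
Proof.
move=> cG aG lG.
have locf x := @locally_finite_closed a G x cG _.
have {}locf x : exists2 d : R, 0 < d & forall n y, ball x d y -> G n y -> G n x.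
  by apply: locf => n y /aG[_]; rewrite in_ball => /negP; rewrite -leNgt.
have disjG n m x : G n x -> G m x -> (n <= m)%N.
  move=> /aG[_] + /aG[+ _]; rewrite !in_ball => /negP; rewrite -leNgt => na am.
  by have := le_lt_trans na am; rewrite ltr_nat ltnS.
split.
  rewrite -openC; apply/metric_openP => x nGx; have [d d0 hd] := locf x.
  by exists d => // y xy [n _ Gy]; apply: nGx; exists n => //; exact: hd Gy.
move=> x [n _ Gnx]; have [d d0 hd] := locf x.
have [L [rho [L0 rho0 hL]]] := lG n.
exists (ball x (Num.min d (rho / 2))).
  by apply: nbhsx_ballx; rewrite lt_min d0 divr_gt0.
have onlyn y : ((\bigcup_n G n) `&` ball x (Num.min d (rho / 2))) y ->
    G n y /\ mdist x y < rho / 2.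
  move=> [[m _ Gmy]]; rewrite in_ball lt_min => /andP[yd yr]; split=> //.
  have Gmx : G m x by apply: hd Gmy; rewrite in_ball.
  suff -> : n = m by [].
  by apply/eqP; rewrite eqn_leq (disjG n m x) ?(disjG m n x).
exists L => y z /onlyn[Gy xy] /onlyn[Gz xz]; apply: hL => //.
by have := metric_triangle y x z; rewrite (metric_sym y x); lra.
Qed.

End Gluing.

(** * Good points *)

Section Stepanov.
Context (R : realType) (X : metricType R) (mu : {outer_measure set X -> \bar R}).
Hypotheses (Xmu : metric_measure_space mu) (dmu : doubling mu).
Variables (E : set X) (f : X -> R).

(** The complement of [E] is included, so that a point outside the bad set can serve
as an intermediate point. *)
Definition bad_set (k : nat) (x : X) : set X :=
  [set z | ~ (E z /\ `|f z - f x| <= k%:R * mdist x z)].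

Definition good_points (eta : R) (k : nat) : set X :=
  [set x | E x /\ forall r, 0 < r -> r < k.+1%:R^-1 ->
    (mu (ball x r `&` bad_set k x) <= eta%:E * mu (ball x r))%E].

Lemma nondecreasing_good_points (eta : R) :
  nondecreasing_seq (good_points eta).
Proof.
move=> m n mn; apply/subsetPset => x [Ex hx]; split=> // r r0 rn.
apply: le_trans (hx r r0 _).
  apply: le_outer_measure => z [xz nz]; split=> // -[Ez fz]; apply: nz.
  split=> //; apply: le_trans fz _; rewrite ler_wpM2r ?mdist_ge0//.
  by rewrite ler_nat.
by apply: lt_le_trans rn _; rewrite lef_pV2 ?posrE ?ltr0n// ler_nat ltnS.
Qed.

(** Put [s = d(x, y)].  If every point of the ball [B(y, s)] were bad for [x] or for
[y], then this ball would lie in the union of two sets, each of measure at most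
[eta] times that of [B(y, 4 s)], hence at most a quarter of the measure of
[B(y, s)].  A point [z] that is bad for neither gives
[|f x - f y| <= k (d(x, z) + d(y, z)) <= 3 k s]. *)
Lemma good_points_lipschitz : exists2 eta : R, 0 < eta &
  forall k, small_scale_lipschitz (good_points eta k) f.
Proof.
have [K K0 hK] := doubling_quadruple dmu.
(* With this value, [eta] times the measure of [B(y, 4 s)] is at most a quarter of
   that of [B(y, s)]. *)
exists (4 * K)^-1; first by rewrite invr_gt0 mulr_gt0.
set eta := (4 * K)^-1; have eta0 : 0 < eta by rewrite invr_gt0 mulr_gt0.
move=> k; exists (3 * k%:R), (k.+1%:R^-1 / 2); split; [by rewrite mulr_ge0|by rewrite divr_gt0|].
move=> x y gx gy xyk.
have [->|xy] := eqVneq x y; first by rewrite subrr normr0 mdistxx mulr0.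
set s := mdist x y in xyk *; have s0 : 0 < s by rewrite mdist_gt0.
have s2k : 2 * s < k.+1%:R^-1 by rewrite mulrC -ltr_pdivlMr.
have small z r : 0 < r -> r <= 2 * s -> ball z r `<=` ball y (4 * s) ->
    good_points eta k z ->
    (mu (ball z r `&` bad_set k z) <= (1 / 4)%:E * mu (ball y s))%E.
  move=> r0 r2s zy [_ hz].
  apply: le_trans (hz r r0 (le_lt_trans r2s s2k)) _.
  apply: (@le_trans _ _ (eta%:E * (K%:E * mu (ball y s)))%E).
    apply: lee_wpmul2l; first by rewrite lee_fin ltW.
    by apply: le_trans (hK y s s0); exact: le_outer_measure.
  rewrite muleA -EFinM /eta invfM -mulrA mulVf ?mulr1 ?gt_eqF// mul1r.
  exact: lexx.
have [z [yz xz yz']] : exists z, [/\ ball y s z, ~ bad_set k x z & ~ bad_set k y z].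
  apply: contrapT => noz.
  have sub : ball y s `<=` (ball x (2 * s) `&` bad_set k x) `|`
      (ball y s `&` bad_set k y).
    move=> z yz; have [bx|bx] := pselect (bad_set k x z).
      left; split=> //; move: yz; rewrite !in_ball => yz.
      by have := metric_triangle x y z; rewrite -/s; lra.
    right; split=> //; apply: contrapT => bY; apply: noz; by exists z.
  have := le_trans (le_outer_measure mu _ _ sub) (outer_measureU2 _ _ _).
  apply/negP; rewrite -ltNge.
  apply: (@le_lt_trans _ _ ((1 / 4)%:E * mu (ball y s) + (1 / 4)%:E * mu (ball y s))%E).
    apply: leeD; apply: small => //.
    - by rewrite mulr_gt0.
    - by apply: ball_subset; rewrite metric_sym -/s; lra.
    - by lra.
    - by apply: ball_subset; rewrite mdistxx; lra.
  rewrite -fineK_mu_ball// -!EFinM -EFinD lte_fin.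
  by have := fine_mu_ball_gt0 Xmu dmu y s0; lra.
have [_ fzx] : E z /\ `|f z - f x| <= k%:R * mdist x z by exact: contrapT.
have [_ fzy] : E z /\ `|f z - f y| <= k%:R * mdist y z by exact: contrapT.
move: yz; rewrite in_ball => yz.
have xz2 : mdist x z <= 2 * s by have := metric_triangle x y z; rewrite -/s; lra.
have k0 : 0 <= k%:R :> R by [].
have -> : f x - f y = - (f z - f x) + (f z - f y) by lra.
apply: le_trans (ler_normD _ _) _; rewrite normrN.
have := ler_wpM2l k0 xz2; have := ler_wpM2l k0 (ltW yz); lra.
Qed.

(** Once [k] is above the level [a], a point that is bad for [x] lies outside [E] or in
the superlevel set of the difference quotient; each of these two sets takes at most
the fraction [eta / 2] of small balls. *)
Lemma good_points_cover (eta : R) (x : X) : 0 < eta -> E x ->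
  density_zero mu (~` E) x ->
  (ap_limsup mu (E `\ x) (fun y => `|f y - f x| / mdist x y)%R x < +oo)%E ->
  (\bigcup_k good_points eta k) x.
Proof.
move=> eta0 Ex /density_zeroP dE /ereal_inf_lt[_ [a /density_zeroP da <-] _].
have eta20 : 0 < eta / 2 by rewrite divr_gt0.
have [d1 d10 h1] := dE Xmu dmu _ eta20; have [d2 d20 h2] := da Xmu dmu _ eta20.
have d0 : 0 < Num.min d1 d2 by rewrite lt_min d10.
have [n] := ltr_add_invr d0; rewrite add0r => nd.
(* [n] makes the scale [k.+1^-1] small, the other term makes [k] exceed [a]. *)
pose k := maxn n (Num.truncn a).+1; exists k => //; split=> // r r0 rk.
have ak : a <= k%:R.
  apply: ltW; apply: lt_le_trans (truncnS_gt a) _.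
  by rewrite ler_nat leq_maxr.
have /andP[rd1 rd2] : (r < d1) && (r < d2).
  rewrite -lt_min; apply: lt_trans nd; apply: lt_le_trans rk _.
  by rewrite lef_pV2 ?posrE ?ltr0n// ler_nat ltnS leq_maxl.
set S := [set y | _] in h2.
apply: (@le_trans _ _ (mu ((ball x r `&` ~` E) `|` (ball x r `&` S)))).
  apply: le_outer_measure => z [xz bz].
  have [Ez|nEz] := pselect (E z); last by left.
  right; split=> //.
  have kfz : k%:R * mdist x z < `|f z - f x|.
    by rewrite ltNge; apply/negP => fz; apply: bz.
  have zx : z != x.
    by apply: contraPneq kfz => ->; rewrite mdistxx subrr normr0 mulr0 ltxx.
  split; first by split=> //; exact/eqP.
  rewrite ltr_pdivlMr; last by rewrite mdist_gt0 eq_sym.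
  by apply: le_lt_trans kfz; rewrite ler_wpM2r// mdist_ge0.
apply: le_trans (outer_measureU2 _ _ _) _.
rewrite [eta]splitr EFinD ge0_muleDl ?lee_fin ?(ltW eta20)//.
by apply: leeD; [exact: h1|exact: h2].
Qed.

End Stepanov.

(** * The two implications *)

Section MainDirections.
Context (R : realType) (X : metricType R) (mu : {outer_measure set X -> \bar R}).
Hypotheses (Xmu : metric_measure_space mu) (dmu : doubling mu).
Variables (E : set X) (f : X -> R).
Hypothesis mE : mu.-caratheodory E.

(** Finite measure is what the extraction of closed pieces requires; cutting [E] along
annuli reduces the general case to it. *)
Lemma ap_limsup_lusin_lipschitz (e : R) : mu_measurable_fun mu E f ->
  mu_ae_in mu E (fun x =>
    (ap_limsup mu (E `\ x) (fun y => `|f y - f x| / mdist x y)%R x < +oo)%E) ->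
  0 < e ->
  exists G : set X, [/\ closed G, G `<=` E, (mu (E `\` G) <= e%:E)%E &
         locally_lipschitz_on G f].
Proof.
move=> mf aeE e0; have [_ _ _ [bor hull]] := Xmu.
have [a _] := metric_measure_nonempty Xmu.
have [eta eta0 lip] := good_points_lipschitz Xmu dmu E f.
pose A n := E `&` (ball a n.+1%:R `\` ball a n%:R).
have mball r : mu.-caratheodory (ball a r).
  by apply: open_caratheodory => //; exact: metric_ball_open.
have mA n : mu.-caratheodory (A n).
  apply: caratheodory_measurable_setI => //.
  exact: caratheodory_measurable_setD.
have null n : mu (A n `\` \bigcup_k good_points mu E f eta k) = 0%E.
  pose N b := if b is 0%N then [set x | E x /\ ~ density_zero mu (~` E) x]
    else [set x | E x /\ ~ (ap_limsup mu (E `\ x)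
      (fun y => `|f y - f x| / mdist x y)%R x < +oo)%E].
  apply: (@outer_measure_subnull _ _ _ _ (\bigcup_n N n)).
    move=> x [[Ex _] nx].
    have [dx|dx] := pselect (density_zero mu (~` E) x); last by exists 0%N.
    by exists 1%N => //; split=> // ax; apply: nx; exact: good_points_cover.
  by apply: outer_measure_bigcup_null => -[|n']//=; exact: density_theorem.
have /choice[G GP] n : exists G, [/\ closed G, G `<=` A n,
    (mu (A n `\` G) <= (e / (2 ^ n.+1)%:R)%:E)%E & small_scale_lipschitz G f].
  apply: (lusin_lipschitz bor hull (metric_ball_open a n.+1%:R)
    (mu_ball_fin Xmu dmu _ _) (mA n) _ _
    (@nondecreasing_good_points _ _ mu E f eta) lip (null n)).
  - by move=> x [_ []].
  - move=> Y mY; rewrite -setIA [_ `&` (f @^-1` Y)]setIC setIA.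
    by apply: caratheodory_measurable_setI; [exact: mf|
      exact: caratheodory_measurable_setD].
  - by rewrite divr_gt0// ltr0n expn_gt0.
have [cG lG] : closed (\bigcup_n G n) /\ locally_lipschitz_on (\bigcup_n G n) f.
  apply: (@glue_annuli _ _ a) => n; have [? GA ? ?] := GP n => //.
  by move=> x /GA[].
exists (\bigcup_n G n); split=> //.
  by move=> x [n _ Gx]; have [_ + _ _] := GP n => /(_ x Gx)[].
apply: (@le_trans _ _ (mu (\bigcup_n (A n `\` G n)))).
  apply: le_outer_measure => x [Ex nGx].
  have /andP[tl tr] := truncn_itv (mdist_ge0 a x).
  exists (Num.truncn (mdist a x)) => //; split; last first.
    by move=> Gx; apply: nGx; exists (Num.truncn (mdist a x)).
  split=> //; split; first by rewrite in_ball.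
  by rewrite in_ball; apply/negP; rewrite -leNgt.
by apply: outer_measure_bigcup_eps => [|n]; [exact: ltW|have [] := GP n].
Qed.

Lemma ap_limsup_density (G : set X) (x : X) : G `<=` E -> G x ->
  locally_lipschitz_on G f -> density_zero mu (~` G) x ->
  (ap_limsup mu (E `\ x) (fun y => `|f y - f x| / mdist x y)%R x < +oo)%E.
Proof.
move=> GE Gx lG dG; have [U /nbhs_ballP[r /= r0 rU] [L hL]] := lG x Gx.
apply: le_lt_trans (ltry L); apply: ereal_inf_lbound; exists L => //=.
apply: (density_zero_subset Xmu dmu _ dG); exists r => //.
move=> y [xy [[Ey yx]]] /[swap] Gy; apply/negP; rewrite -leNgt.
have xy0 : 0 < mdist x y by rewrite mdist_gt0 eq_sym; exact/eqP.
rewrite ler_pdivrMr// (metric_sym x y); apply: hL; split=> //.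
  exact: rU.
by apply: rU; rewrite in_ball mdistxx.
Qed.

Lemma lusin_lipschitz_ap_limsup :
  (forall eps : R, 0 < eps -> exists G : set X,
     [/\ closed G, G `<=` E, (mu (E `\` G) <= eps%:E)%E &
         locally_lipschitz_on G f]) ->
  mu_ae_in mu E (fun x =>
    (ap_limsup mu (E `\ x) (fun y => `|f y - f x| / mdist x y)%R x < +oo)%E).
Proof.
move=> hG; have [_ _ _ [bor _]] := Xmu.
apply: outer_measure_null => e /hG[G [cG GE EG lG]]; apply: le_trans EG.
pose Z := [set x | G x /\ ~ density_zero mu (~` G) x].
apply: (@le_trans _ _ (mu ((E `\` G) `|` Z))).
  apply: le_outer_measure => x [Ex nx].
  have [Gx|Gx] := pselect (G x); last by left.
  by right; split=> // dG; apply: nx; exact: ap_limsup_density dG.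
apply: le_trans (outer_measureU2 _ _ _) _.
rewrite (density_theorem Xmu dmu) ?adde0//; exact: closed_caratheodory.
Qed.

End MainDirections.

(** * Approximate Lipschitz condition and Lusin approximation *)

(* Only the values of f on E matter: f stands for a function E -> R. *)
Theorem theorem2p3 (R : realType) (X : metricType R)
    (mu : {outer_measure set X -> \bar R})
    (Xmu : metric_measure_space mu) (mu_doubling : doubling mu)
    (E : set X) (mE : mu.-caratheodory E)
    (f : X -> R) (mf : mu_measurable_fun mu E f) :
  mu_ae_in mu E (fun x =>
    (ap_limsup mu (E `\ x) (fun y => `|f y - f x| / mdist x y)%R x < +oo)%E) <->
  (forall eps : R, 0 < eps -> exists G : set X,
     [/\ closed G, G `<=` E, (mu (E `\` G) <= eps%:E)%E &
         locally_lipschitz_on G f]).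
Proof.
split=> [aeE eps eps0|]; last exact: lusin_lipschitz_ap_limsup.
exact: ap_limsup_lusin_lipschitz.
Qed.
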